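(* Let $A$ be an abelian group. Then $\mathcal{S}(A)$ is non-perfect (i.e. contains an isolated point) if and only if $A$ is minimax. In particular: (a) if $A$ is countable and not minimax, then $\mathcal{S}(A)$ is homeomorphic to a Cantor set; (b) if $A$ is uncountable, then $\mathcal{S}(A)$ is perfect.
   Context: For an abelian group $A$, $\mathcal{S}(A)$ denotes the set of all subgroups of $A$, with the topology induced by the product topology on the set $2^A$ of all subsets of $A$ (Chabauty topology); it is a compact, totally disconnected Hausdorff space. A topological space is perfect if it has no isolated point. An abelian group is Artinian if every non-increasing sequence of subgroups stabilizes. An abelian group $A$ is minimax if it has a finitely generated subgroup $Z$ with $A/Z$ Artinian. *)

(* Defs.v *)
From HB Require Import structures.
From mathcomp Require Import all_boot all_order all_algebra.
From mathcomp Require Import boolp classical_sets functions cardinality.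
From mathcomp Require Import reals topology cantor.

Set Implicit Arguments.
Unset Strict Implicit.
Unset Printing Implicit Defensive.

Import GRing.Theory.

Local Open Scope classical_set_scope.
Local Open Scope ring_scope.

(* A subset of A is encoded by its characteristic function A -> bool, so that
   2^A is a power of the discrete space bool. *)
Definition subgroups (A : zmodType) : set (prod_topology (fun _ : A => bool)) :=
  [set H | GRing.zmod_closed (H : {pred A})].

Arguments subgroups : clear implicits.

Definition subgroup_space (A : zmodType) : topologicalType :=
  set_type (subgroups A).

Definition perfect_space (T : topologicalType) : Prop :=
  ~ exists x : T, isolated [set: T] x.

Definition homeomorphic (T U : topologicalType) : Prop :=
  exists (f : T -> U) (g : U -> T),
    [/\ continuous f, continuous g, cancel f g & cancel g f].

Definition artinian (A : zmodType) : Prop :=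
  forall H : nat -> zmodClosed A,
    (forall n, {subset H n.+1 <= H n}) ->
    exists n, forall m, (n <= m)%N -> H m =i H n.

Definition finitely_generated (A : zmodType) (Z : zmodClosed A) : Prop :=
  exists s : seq A, {subset s <= Z} /\
    forall K : zmodClosed A, {subset s <= K} -> {subset Z <= K}.

Definition minimax (A : zmodType) : Prop :=
  exists Z : zmodClosed A,
    finitely_generated Z /\ artinian (Quotient.quot Z).

(* Main.v *)
Require Import Defs.
From HB Require Import structures.
From mathcomp Require Import all_boot all_order all_algebra.
From mathcomp Require Import boolp classical_sets functions cardinality.
From mathcomp Require Import reals topology cantor Rstruct.

(* Call an abelian group B finitely discriminable if some finite set of nonzero
   elements meets every nontrivial subgroup of B. A basic neighbourhood of a
   subgroup Z is cut out by finitely many elements to be kept and finitely many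
   to be avoided, so Z is isolated iff Z is finitely generated and A/Z is
   finitely discriminable; it remains to see that finitely discriminable means
   Artinian.
   - If B is Artinian (hence torsion) but not finitely discriminable, one
     chooses x_n <> 0 with <x_n> disjoint from the finite group
     <x_0, ..., x_(n-1)>, and the subgroups <x_k | k >= n> strictly decrease.
   - If B is finitely discriminable, then B is torsion, each n-torsion part is
     finite, and for almost every prime p there is no p-torsion. For a
     descending chain H_n with intersection L, the group (B/L)[m] is no larger
     than B[m], hence finite, so some H_n/L has no m-torsion; taking for m an
     exponent of the discriminating set forces H_n = L.
   Finitely discriminable groups are unions of their finite torsion parts, so
   minimax groups are countable. When A is countable, the space of subgroups is
   a metrizable zero-dimensional compact space and Brouwer's characterization
   of the Cantor space applies. *)

Set Implicit Arguments.
Unset Strict Implicit.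
Unset Printing Implicit Defensive.

Import GRing.Theory.

Local Open Scope ring_scope.
Local Open Scope classical_set_scope.

(** * Spans of sequences, cyclic subgroups and torsion *)

Section Subgroups.
Variable A : zmodType.
Implicit Types (x y : A) (H K : zmodClosed A) (f : nat -> A).

Definition zmod_of (S : {pred A}) (zmodS : GRing.zmod_closed S) :
    zmodClosed A :=
  HB.pack (S : A -> bool) (GRing.isZmodClosed.Build A S zmodS).

(** The index interval serves two uses: [span f 0 n] for initial segments, and the union of
    [span f n m] over [m] for tails. *)
Definition span f m n : {pred A} :=
  [pred y | `[< exists c : nat -> int, y = \sum_(m <= k < n) f k *~ c k >]].

Lemma spanP f m n y :
  reflect (exists c : nat -> int, y = \sum_(m <= k < n) f k *~ c k)
    (y \in span f m n).
Proof. exact: asboolP. Qed.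

Lemma span_closed f m n : GRing.zmod_closed (span f m n).
Proof.
split; first by apply/spanP; exists (fun=> 0); rewrite big1.
move=> _ _ /spanP[c ->] /spanP[d ->]; apply/spanP; exists (fun k => c k - d k).
by rewrite -sumrB; apply: eq_bigr => k _; rewrite mulrzBr.
Qed.

HB.instance Definition _ f m n :=
  GRing.isZmodClosed.Build A (span f m n) (span_closed f m n).

Lemma mem_span f m n k : (m <= k < n)%N -> f k \in span f m n.
Proof.
move=> kmn; apply/spanP; exists (fun i => (i == k)%:Z).
rewrite (bigD1_seq k) ?mem_index_iota ?iota_uniq //= eqxx mulr1z big1 ?addr0 //.
by move=> i /negPf->.
Qed.

Lemma span_sub f m n K :
  (forall k, (m <= k < n)%N -> f k \in K) -> {subset span f m n <= K}.
Proof.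
move=> fK _ /spanP[c ->]; rewrite big_seq; apply: rpred_sum => k.
by rewrite mem_index_iota => kmn; rewrite rpredMz ?fK.
Qed.

Lemma span_mono f m n m' n' :
  (m' <= m)%N -> (n <= n')%N -> {subset span f m n <= span f m' n'}.
Proof.
move=> mm' nn'; apply: span_sub => k /andP[mk kn]; apply: mem_span.
by rewrite (leq_trans mm') ?(leq_trans kn).
Qed.

Definition cyc x : {pred A} := span (fun=> x) 0 1.

Lemma cycP x y : reflect (exists k : int, y = x *~ k) (y \in cyc x).
Proof.
apply: (iffP (spanP _ _ _ _)) => [[c ->]|[k ->]].
  by exists (c 0); rewrite big_nat1.
by exists (fun=> k); rewrite big_nat1.
Qed.

Lemma cyc_id x : x \in cyc x. Proof. exact: (@mem_span (fun=> x) 0 1 0). Qed.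

HB.instance Definition _ x := GRing.ZmodClosed.on (cyc x).

Definition discriminating (E : seq A) :=
  0 \notin E /\
  forall K, (exists2 x, x \in K & x != 0) -> exists2 e, e \in E & e \in K.

Definition finitely_discriminable := exists E, discriminating E.

Definition torsion := forall x, exists2 n, (0 < n)%N & x *+ n = 0.

Lemma mulrn_modn x n k : x *+ n = 0 -> x *+ (k %% n) = x *+ k.
Proof.
move=> xn; rewrite [in RHS](divn_eq k n) mulrnDr mulnC mulrnA.
by rewrite xn mul0rn add0r.
Qed.

Lemma mulrn_coprime x a b :
  (0 < b)%N -> x *+ a = 0 -> x *+ b = 0 -> coprime a b -> x = 0.
Proof.
move=> b0 xa xb; rewrite coprime_sym => cab.
have [u v Huv _] := egcdnP a b0.
have := congr1 (fun k => x *+ k) Huv; rewrite mulnC mulrnA xb mul0rn.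
by rewrite (eqP cab) mulrnDr mulnC mulrnA xa mul0rn add0r.
Qed.

Lemma mulrz_absz_eq0 x (k : int) : x *~ k = 0 -> x *+ `|k| = 0.
Proof. by case: k => n //= /eqP; rewrite NegzE mulrNz oppr_eq0 => /eqP. Qed.

(** Each coefficient can be reduced modulo an exponent of its generator, which leaves finitely many
    combinations. *)
Lemma torsion_span_finite f n : torsion ->
  exists l : seq A, {subset span f 0 n <= l}.
Proof.
move=> tA; elim: n => [|n [l lP]].
  by exists [:: 0] => _ /spanP[c ->]; rewrite big_geq ?inE.
have [d d0 fd] := tA (f n).
exists [seq u + f n *+ j | u <- l, j <- iota 0 d] => _ /spanP[c ->].
rewrite big_nat_recr //=; apply/allpairsP.
exists (\sum_(0 <= k < n) f k *~ c k, `|(c n %% d)%Z|%N); split => /=.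
- by apply: lP; apply/spanP; exists c.
- rewrite mem_iota add0n /=; have d0' : (d%:Z != 0) by rewrite -lt0n.
  by rewrite -ltz_nat gez0_abs ?modz_ge0 // ltz_pmod.
congr (_ + _); rewrite pmulrn gez0_abs ?modz_ge0 -?lt0n //.
rewrite [in LHS](divz_eq (c n) d) mulrzDr mulrC mulrzA.
by rewrite -[f n *~ d]/(f n *+ d) fd mul0rz add0r.
Qed.

End Subgroups.
Arguments finitely_discriminable : clear implicits.
Arguments torsion : clear implicits.

(** * Uniform bounds over finite sets, and induction on prime factors *)

Lemma eventually_all (T : eqType) (P : T -> nat -> Prop) (s : seq T) :
    (forall x, x \in s -> exists m, forall n, (m <= n)%N -> P x n) ->
  exists m, forall n, (m <= n)%N -> forall x, x \in s -> P x n.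
Proof.
elim: s => [|x s IHs] Ps; first by exists 0.
have [y ys|m mP] := IHs; first by apply: Ps; rewrite inE ys orbT.
have [k kP] := Ps x (mem_head _ _).
exists (maxn k m) => n; rewrite geq_max => /andP[kn mn] y.
by rewrite inE => /orP[/eqP->|]; [exact: kP | exact: mP].
Qed.

Lemma prime_factor_ind (P : nat -> Prop) :
    P 1 -> (forall p n, prime p -> (0 < n)%N -> P n -> P (p * n)%N) ->
  forall n, (0 < n)%N -> P n.
Proof.
move=> P1 PM; elim/ltn_ind => n IHn n_gt0.
have [->//|n1] := eqVneq n 1.
have n_gt1 : (1 < n)%N by rewrite ltn_neqAle eq_sym n1.
have pr_p := pdiv_prime n_gt1.
rewrite -(divnK (pdiv_dvd n)) mulnC.
have k_gt0 : (0 < n %/ pdiv n)%N.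
  by rewrite divn_gt0 ?prime_gt0 // dvdn_leq ?pdiv_dvd.
by apply: PM => //; apply: IHn => //; rewrite ltn_Pdiv ?prime_gt1.
Qed.

(** * Finiteness of torsion in finitely discriminable groups *)

Section FinitelyDiscriminable.
Variable A : zmodType.
Implicit Types (x y : A) (H K : zmodClosed A) (f : nat -> A).

Lemma discriminating_mulz (E : seq A) x : discriminating E -> x != 0 ->
  exists2 e, e \in E & exists k : int, e = x *~ k.
Proof.
case=> _ EP x0; have [|e eE /cycP[k ek]] := EP (cyc x).
  by exists x => //; exact: cyc_id.
by exists e => //; exists k.
Qed.

(** If [x] has infinite order, a nonzero element lies in [<(n+1)x>] for only finitely many [n], so
    for large [n] this nontrivial subgroup misses the finite set [E]. *)
Lemma finitely_discriminable_torsion : finitely_discriminable A -> torsion A.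
Proof.
case=> E EP x; have [E0 _] := EP; apply: contrapT => xinf.
have x_inj (k : int) : x *~ k = 0 -> k = 0.
  move=> /mulrz_absz_eq0 xk; apply: contrapT => k0; apply: xinf.
  by exists `|k|%N => //; rewrite absz_gt0; apply/eqP.
have [e eE|m mP] :=
  @eventually_all _ (fun e n => forall k : int, e <> x *+ n.+1 *~ k) E.
  have e0 : e != 0 by apply: contraNneq E0 => <-.
  have [[k ek]|] := pselect (exists k : int, e = x *~ k); last first.
    move=> eN; exists 0 => n _ k ek; apply: eN.
    by exists (n.+1%:Z * k); rewrite mulrzA.
  (* From [kx = (n+1)jx] follows [k = (n+1)j], so [|k| <= n] forces [j = 0] and [e = 0]. *)
  exists `|k|%N => n kn j ej.
  have /x_inj/eqP : x *~ (n.+1%:Z * j - k) = 0.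
    by rewrite mulrzBr mulrzA -ek ej subrr.
  rewrite subr_eq0 => /eqP kE; move: kn; rewrite -kE abszM /= leqNgt.
  rewrite leq_pmulr ?absz_gt0 //; apply: contraNneq e0 => j0.
  by rewrite ej j0.
have [|e eE [k]] := discriminating_mulz (x := x *+ m.+1) EP; last exact: mP.
by apply/eqP => xm; apply: xinf; exists m.+1.
Qed.

(** Induction on prime factors: multiplication by [p] sends [A[pn]] to [A[n]], two elements with the
    same image differ by [p]-torsion, and a nonzero [p]-torsion element is a multiple of some
    element of [E]. *)
Lemma torsion_part_finite n : finitely_discriminable A -> (0 < n)%N ->
  exists l : seq A, forall x, x *+ n = 0 -> x \in l.
Proof.
case=> E EP; have [E0 _] := EP.
elim/prime_factor_ind => [|p {}n pr_p n_gt0 [l lP]].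
  by exists [:: 0] => x; rewrite mulr1n inE => ->.
(* One chosen solution of [pz = y] for each listed [y], plus [0] or a multiple of an element of [E].
   The default [0] of [xget] does no harm: only solvable [y] are used. *)
exists [seq xget 0 [set z | z *+ p = y] + t |
         y <- l, t <- 0 :: [seq e *+ j | e <- E, j <- iota 0 p]] => x.
rewrite mulrnA => /lP xl; apply/allpairsP.
set z := xget 0 [set z | z *+ p = x *+ p].
have zp : z *+ p = x *+ p.
  by apply: (@xgetPex _ 0 [set z | z *+ p = x *+ p]); exists x.
exists (x *+ p, x - z); split => //=; last by rewrite addrC subrK.
rewrite inE subr_eq0; have [//|/= xz] := eqVneq x z; apply/allpairsP.
have xzp : (x - z) *+ p = 0 by rewrite mulrnBl zp subrr.
have [|e eE [k ek]] := discriminating_mulz (x := x - z) EP.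
  by rewrite subr_eq0.
have p0 : p%:Z != 0 by rewrite -lt0n prime_gt0.
(* Put [t = x - z], so that [e = at]. Since [e] is nonzero and [pt = 0], [a] is prime to [p]; its
   inverse [u] modulo [p] gives [t = ue]. *)
pose a := `|(k %% p)%Z|%N.
have ea : e = (x - z) *+ a.
  rewrite pmulrn gez0_abs ?modz_ge0 //.
  rewrite ek [in LHS](divz_eq k p) mulrzDr mulrC mulrzA.
  by rewrite -[(x - z) *~ p]/((x - z) *+ p) xzp mul0rz add0r.
have /(egcdnP p) [u v uv _] : (0 < a)%N.
  rewrite lt0n; apply: contraNneq E0 => a0.
  by rewrite -(mulr0n (x - z)) -a0 -ea.
have ap : coprime a p.
  rewrite coprime_sym prime_coprime //; apply: contra E0 => /dvdnP[c ac].
  by rewrite -(mul0rn _ c) -xzp -mulrnA mulnC -ac -ea.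
exists (e, (u %% p)%N); rewrite eE mem_iota ltn_mod prime_gt0 //; split => //=.
rewrite mulrn_modn; last by rewrite ea -mulrnA mulnC mulrnA xzp mul0rn.
by rewrite ea -mulrnA mulnC uv (eqP ap) mulrnDr mulnC mulrnA xzp mul0rn add0r.
Qed.

(* With F the finite group generated by ws, the cosets w + nF are disjoint in F
   since nF <= H, so |ws| |nF| <= |F| <= |F[n]| |nF|. *)
Lemma incongruent_size H n (b ws : seq A) : torsion A ->
    (forall x, x *+ n = 0 -> x \in b) ->
    uniq ws -> {in ws &, forall x y, x - y \in H -> x = y} ->
    (forall w, w \in ws -> w *+ n \in H) ->
  (size ws <= size b)%N.
Proof.
move=> tA bP uws wsH wsn.
have [l lP] := torsion_span_finite (nth 0 ws) (size ws) tA.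
pose F : zmodClosed A := span (nth 0 ws) 0 (size ws).
pose lF := [seq x <- l | x \in F]; pose nF := undup [seq x *+ n | x <- lF].
have memF x : (x \in lF) = (x \in F) by rewrite mem_filter andb_idr // => /lP.
have wsF w : w \in ws -> w \in F.
  by move=> /(nthP 0)[i iws <-]; apply: mem_span.
have nFP y : reflect (exists2 x, x \in F & y = x *+ n) (y \in nF).
  rewrite mem_undup; apply: (iffP mapP) => -[x].
    by rewrite memF => xF ->; exists x.
  by rewrite -memF => xF ->; exists x.
have FH : {in F, forall x, x *+ n \in H}.
  move=> _ /spanP[c ->]; rewrite -sumrMnl big_nat; apply: rpred_sum => k kws.
  by rewrite pmulrn -mulrzA mulrC mulrzA rpredMz ?wsn ?mem_nth.
have nFF : {subset nF <= F} by move=> _ /nFP[x xF ->]; rewrite rpredMn.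
have nFH : {subset nF <= H} by move=> _ /nFP[x xF ->]; rewrite FH.
pose s y := xget 0 [set x | x \in F /\ x *+ n = y].
have sP y : y \in nF -> s y \in F /\ s y *+ n = y.
  case/nFP => x xF ->.
  apply: (@xgetPex _ 0 [set z | z \in F /\ z *+ n = x *+ n]).
  by exists x.
(* With [s] a section of multiplication by [n], [g] embeds [F] into the product of [nF] and the
   [n]-torsion. *)
pose g z := (z *+ n, z - s (z *+ n)).
have g_inj : injective g by move=> z z' [-> /addIr].
have nF_gt0 : (0 < size nF)%N.
  rewrite -has_predT; apply/hasP; exists 0 => //.
  by apply/nFP; exists 0; rewrite ?rpred0 ?mul0rn.
rewrite -(leq_pmul2r nF_gt0) [leqRHS]mulnC -!(size_allpairs pair).
rewrite size_allpairs -(size_allpairs (fun w y => w + y)) -(size_map g).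
apply: uniq_leq_size => [|_ /mapP[_ /allpairsP[[w y] /= [wws ynF ->]] ->]].
  rewrite map_inj_uniq //; apply: allpairs_uniq => //; first exact: undup_uniq.
  move=> _ _ /allpairsP[[w y] /= [ww yn ->]]
          /allpairsP[[w' y'] /= [ww' yn' ->]] /= wy.
  have ww'E : w = w'.
    apply: wsH => //; rewrite (_ : w - w' = y' - y) ?rpredB ?nFH //.
    by apply/eqP; rewrite subr_eq addrAC eq_sym subr_eq wy addrC.
  by move: wy; rewrite ww'E => /addrI->.
have wyF : w + y \in F by apply: rpredD; [exact: wsF | exact: nFF].
have wyn : (w + y) *+ n \in nF by apply/nFP; exists (w + y).
apply/allpairsP; exists (g (w + y)); split => /=; [exact: wyn| |by []].
by apply: bP; rewrite mulrnBl (sP _ wyn).2 subrr.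
Qed.

End FinitelyDiscriminable.

(** * Equivalence of finitely discriminable and Artinian *)

Section Artinian.
Variable A : zmodType.
Implicit Types (x y : A) (H K : zmodClosed A) (f : nat -> A).

(** If [q] divided the least positive annihilator [j] of [y], then [(j/q)y] would be killed by [q],
    hence zero, against minimality. *)
Lemma prime_to_annihilator q y : torsion A -> prime q ->
    (forall x, x *+ q = 0 -> x = 0) ->
  exists2 j, coprime q j & y *+ j = 0.
Proof.
move=> tA pr_q q_inj.
have exj : exists j, (0 < j)%N && (y *+ j == 0).
  by have [j j_gt0 yj] := tA y; exists j; rewrite j_gt0 yj eqxx.
case: (ex_minnP exj) => j /andP[j_gt0 /eqP yj] j_min.
exists j => //; rewrite prime_coprime //; apply/negP => qj.
have yq0 : y *+ (j %/ q) = 0 by apply: q_inj; rewrite -mulrnA divnK.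
have /j_min : (0 < j %/ q)%N && (y *+ (j %/ q) == 0).
  by rewrite yq0 eqxx andbT divn_gt0 ?prime_gt0 //; exact: dvdn_leq.
by rewrite leqNgt ltn_Pdiv ?prime_gt1.
Qed.

Lemma discriminating_exponent (E : seq A) : torsion A ->
  exists2 n, (0 < n)%N & {in E, forall e, e *+ n = 0}.
Proof.
move=> tA; elim: E => [|e E [n n_gt0 En]]; first by exists 1.
have [k k_gt0 ek] := tA e.
exists (k * n)%N; first by rewrite muln_gt0 k_gt0.
move=> x; rewrite inE => /orP[/eqP->|/En xn]; first by rewrite mulrnA ek mul0rn.
by rewrite mulnC mulrnA xn mul0rn.
Qed.

Lemma descending_sub (H : nat -> zmodClosed A) :
    (forall n, {subset H n.+1 <= H n}) ->
  forall m n, (m <= n)%N -> {subset H n <= H m}.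
Proof.
move=> decH m n /subnK<-; elim: (n - m)%N => // k IHk x xH.
by apply: IHk; apply: decH.
Qed.

Lemma inter_closed (H : nat -> zmodClosed A) :
  GRing.zmod_closed [pred x | `[< forall n, x \in H n >]].
Proof.
split=> [|x y /asboolP xH /asboolP yH]; apply/asboolP => n; first exact: rpred0.
by rewrite rpredB.
Qed.

Lemma finitely_discriminable_artinian : finitely_discriminable A -> artinian A.
Proof.
move=> fdA H decH; have tA := finitely_discriminable_torsion fdA.
have subH := descending_sub decH.
have [E EP] := fdA; have [m m_gt0 Em] := discriminating_exponent E tA.
have [b bP] := torsion_part_finite fdA m_gt0.
pose L := zmod_of (inter_closed H).
have LP x : reflect (forall n, x \in H n) (x \in L) by exact: asboolP.
(* Some [H n / L] has no [m]-torsion: otherwise [large] builds arbitrarily many elements, pairwise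
   incongruent modulo [L], whose [m]-multiples lie in [L], and [incongruent_size] bounds their
   number. *)
have [n nP] : exists n, forall w, w \in H n -> w *+ m \in L -> w \in L.
  apply: contrapT => nN.
  have large k n : exists ws : seq A, [/\ uniq ws, size ws = k,
      {in ws &, forall x y, x - y \in L -> x = y} &
      forall w, w \in ws -> w \in H n /\ w *+ m \in L].
    elim: k n => [|k IHk] n; first by exists [::].
    have [w /not_implyP[wH /not_implyP[wm wL]]] : exists w,
        ~ (w \in H n -> w *+ m \in L -> w \in L).
      by apply/existsNP => all_w; apply: nN; exists n.
    (* As [w] is outside [H n'], choosing the remaining elements inside [H n'] keeps [w] incongruent
       to all of them modulo [L]. *)
    have /existsNP[n' wn'] : ~ forall i, w \in H i by move/LP.
    have [ws [uws sws wsL wsP]] := IHk (maxn n n').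
    have wsn' u : u \in ws -> u \in H n'.
      by move=> /wsP[+ _]; apply: subH; exact: leq_maxr.
    have wN u : u \in ws -> ~ w - u \in L.
      by move=> /wsn' uH /LP/(_ n'); rewrite rpredBr.
    exists (w :: ws); split.
    - by rewrite cons_uniq uws andbT; apply/negP => /wsn'.
    - by rewrite -sws.
    - move=> x y; rewrite !in_cons => /orP[/eqP->|xws] /orP[/eqP->|yws] //.
      + by move=> wy; case: (wN _ yws wy).
      + by rewrite -rpredN opprB => wx; case: (wN _ xws wx).
      + exact: wsL.
    - move=> u; rewrite inE => /orP[/eqP->//|/wsP[uH um]]; split => //.
      by apply: subH uH; exact: leq_maxl.
  have [ws [uws sws wsL wsP]] := large (size b).+1 0.
  have := incongruent_size tA bP uws wsL (fun w ww => (wsP w ww).2).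
  by rewrite sws ltnn.
(* If [q] divides [m], then [my] is in [L] and [nP] applies. If not, there is no [q]-torsion, since
   [E] is killed by [m]; so [y] has an annihilator prime to [q] and is a multiple of [qy]. *)
have step q y : prime q -> y \in H n -> y *+ q \in L -> y \in L.
  move=> pr_q yH yq; have [qm|qm] := boolP (q %| m)%N.
    by apply: nP => //; rewrite -(divnK qm) mulnC mulrnA rpredMn.
  have q_inj x : x *+ q = 0 -> x = 0.
    move=> xq; apply: contrapT => /eqP /(discriminating_mulz EP)[e eE [k ek]].
    case: EP => /negP[]; suff <- : e = 0 by [].
    apply: (mulrn_coprime (a := q) m_gt0 _ (Em e eE)).
      by rewrite ek pmulrn mulrzAC -pmulrn xq mul0rz.
    by rewrite prime_coprime.
  have [j qj yj] := prime_to_annihilator y tA pr_q q_inj.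
  have [u v uv _] := egcdnP j (prime_gt0 pr_q).
  have -> : y = y *+ q *+ u.
    by rewrite -mulrnA mulnC uv (eqP qj) mulrnDr mulnC mulrnA yj mul0rn add0r.
  by rewrite rpredMn.
(* A positive multiple of [x] is [0], which lies in [L]; its prime factors are cancelled one by
   one. *)
have HL : {subset H n <= L}.
  move=> x xH; have [k k_gt0 xk] := tA x.
  have {xk} : x *+ k \in L by rewrite xk rpred0.
  move: k_gt0 x xH; elim/prime_factor_ind => [|p {}k pr_p _ IHk] x xH.
    by rewrite mulr1n.
  rewrite mulrnA => /IHk; rewrite rpredMn // => /(_ isT); exact: step.
exists n => k nk x; apply/idP/idP; first exact: subH.
by move/HL/LP.
Qed.

(** The chain [<2^n x>] stabilizes, so [2^n x = 2^(n+1) k x] for some [k], and [2^n (2k - 1)] kills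
    [x]; it is nonzero because [2k - 1] is odd. *)
Lemma artinian_torsion : artinian A -> torsion A.
Proof.
move=> artA x; have [|n nP] := artA (fun n => cyc (x *+ 2 ^ n)).
  move=> n _ /cycP[k ->]; rewrite expnS mulnC mulrnA.
  by rewrite rpredMz // rpredMn // cyc_id.
have /cycP[k xk] : x *+ 2 ^ n \in cyc (x *+ 2 ^ n.+1) by rewrite nP ?cyc_id.
have k2 : k * 2 - 1 != 0.
  rewrite subr_eq0; apply/eqP => /(congr1 (fun z => (z %% 2)%Z)).
  by rewrite modzMl.
exists (2 ^ n * `|(k * 2 - 1)%R|)%N.
  by rewrite muln_gt0 expn_gt0 absz_gt0.
rewrite mulrnA; apply: mulrz_absz_eq0; rewrite mulrzBr mulr1z mulrC mulrzA.
by rewrite -[_ *~ 2]mulrnA -expnSr -xk subrr.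
Qed.

(** The terms already chosen span a finite group whose nonzero elements do not discriminate. Some
    nontrivial subgroup avoids them all, and any nonzero element of it can come next. *)
Lemma independent_sequence : torsion A -> ~ finitely_discriminable A ->
  exists f, forall n, f n != 0 /\
    forall c : int, f n *~ c \in span f 0 n -> f n *~ c = 0.
Proof.
move=> tA nfd.
have ex_next (s : seq A) : exists x, x != 0 /\
    forall c : int, x *~ c \in span (nth 0 s) 0 (size s) -> x *~ c = 0.
  have [l lP] := torsion_span_finite (nth 0 s) (size s) tA.
  apply: contrapT => nx; apply: nfd.
  exists [seq y <- l | (y != 0) && (y \in span (nth 0 s) 0 (size s))].
  split; first by rewrite mem_filter eqxx.
  move=> K [x xK x0]; apply: contrapT => Kl; apply: nx.
  exists x; split => // c xc.
  apply: contrapT => /eqP xc0; apply: Kl.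
  exists (x *~ c); last by rewrite rpredMz.
  by rewrite mem_filter xc0 xc lP.
have [next nextP] := choice ex_next.
(* Each choice depends on all earlier ones, so the recursion carries the list of the first [n]
   terms. *)
pose prev := fix prev n :=
  if n is m.+1 then rcons (prev m) (next (prev m)) else [::].
pose f n := next (prev n).
have prevE n : prev n = mkseq f n.
  elim: n => // n IHn.
  by rewrite /mkseq -addn1 iotaD map_cat -/(mkseq f n) -IHn addn1 cats1.
exists f => n; have [fn0 fnP] := nextP (prev n); split=> // c fc.
suff sub : {subset span f 0 n <= span (nth 0 (prev n)) 0 (size (prev n))}.
  by apply: fnP; exact: sub.
rewrite prevE size_mkseq; apply: span_sub => k /andP[_ kn].
by rewrite -(nth_mkseq 0 f kn) mem_span.
Qed.

Lemma artinian_finitely_discriminable : artinian A -> finitely_discriminable A.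
Proof.
move=> artA; have tA := artinian_torsion artA.
apply: contrapT => /(independent_sequence tA)[f fP].
have tail_closed n :
    GRing.zmod_closed [pred y | `[< exists m, y \in span f n m >]].
  split=> [|x y /asboolP[m xm] /asboolP[m' ym']]; apply/asboolP.
    by exists 0; exact: rpred0.
  exists (maxn m m'); apply: rpredB; first exact: span_mono (leq_maxl _ _) _ xm.
  exact: span_mono (leq_maxr _ _) _ ym'.
have [|n nP] := artA (fun n => zmod_of (tail_closed n)).
  move=> n x /asboolP[m xm]; apply/asboolP; exists m.
  exact: span_mono (leqnSn n) (leqnn m) _ xm.
have : f n \in zmod_of (tail_closed n.+1).
  by rewrite nP //; apply/asboolP; exists n.+1; rewrite mem_span // leqnn ltnSn.
(* Independence removes the last term of the sum: [f m *~ c m] is [f n] minus earlier terms, so it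
   lies in [span f 0 m] and vanishes. Descending to an empty sum gives [f n = 0]. *)
case/asboolP => m; elim: m => [|m IHm] /spanP[c].
  by rewrite big_geq //; apply/eqP; exact: (fP n).1.
have [nm|mn] := ltnP n m; last first.
  by rewrite big_geq //; apply/eqP; exact: (fP n).1.
rewrite big_nat_recr //= => fnE; apply: IHm; apply/spanP; exists c.
rewrite [LHS]fnE (fP m).2 ?addr0 //.
rewrite (_ : f m *~ c m = f n - \sum_(n.+1 <= k < m) f k *~ c k).
  rewrite rpredB ?mem_span //; apply: (@span_mono _ f n.+1 m) => //.
  by apply/spanP; exists c.
by rewrite [X in _ = X - _]fnE addrAC subrr add0r.
Qed.

(** * Countability of minimax groups *)

Lemma finitely_discriminable_countable :
  finitely_discriminable A -> countable [set: A].
Proof.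
move=> fdA; have tA := finitely_discriminable_torsion fdA.
have /choice[l lP] n : exists l : seq A, forall x, x *+ n.+1 = 0 -> x \in l.
  exact: torsion_part_finite.
apply: (@sub_countable _ _ _ (\bigcup_n [set` l n])); last first.
  by apply: bigcup_countable => // n _; exact/finite_set_countable/finite_seq.
apply: subset_card_le => x _; have [[//|n] _ xn] := tA x.
by exists n => //=; apply: lP.
Qed.

Lemma finitely_generated_countable H :
  finitely_generated H -> countable [set` H].
Proof.
case=> s [_ sP].
pose g (c : seq int) := \sum_(0 <= k < size s) s`_k *~ c`_k.
apply: (@sub_countable _ _ _ (range g)); last first.
  exact: sub_countable (card_image_le _ _) (countableP _).
apply: subset_card_le => x /= xH.
have : x \in span (nth 0 s) 0 (size s).
  apply: (sP (span (nth 0 s) 0 (size s))) xH => y /(nthP 0)[k ks <-].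
  exact: mem_span.
case/spanP => c ->; exists (mkseq c (size s)) => //.
by apply: eq_big_nat => k /andP[_ ks]; rewrite nth_mkseq.
Qed.

End Artinian.

(** Every element is the representative of its class plus an element of [Z], and both the quotient
    and [Z] are countable. *)
Lemma minimax_countable (A : zmodType) : minimax A -> countable [set: A].
Proof.
case=> Z [fgZ /artinian_finitely_discriminable].
move=> /finitely_discriminable_countable cQ.
pose g (u : Quotient.quot Z * A) := repr u.1 + u.2.
apply: (@sub_countable _ _ _ (g @` (setT `*` [set` Z]))).
  apply: subset_card_le => x _; pose q := \pi_(Quotient.quot Z)%qT x.
  exists (q, x - repr q); last by rewrite /g /= addrC subrK.
  by split => //=; rewrite Quotient.idealrBE reprK.
apply: sub_countable (card_image_le _ _) _; apply: countableX => //.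
exact: finitely_generated_countable.
Qed.

(** * Neighbourhoods in the Chabauty topology and isolated subgroups *)

Lemma nbhs_cylinder (I : eqType) (g : {ptws I -> bool})
    (V : set {ptws I -> bool}) :
  nbhs g V <-> exists s : seq I, forall h, {in s, h =1 g} -> V h.
Proof.
split=> [|[s]]; last first.
  elim: s V => [|i s IHs] V sV.
    by apply: filterS filterT => h _; apply: sV.
  have gi : nbhs g [set h : {ptws I -> bool} | h i = g i].
    apply: (@proj_continuous _ (fun _ : I => bool) i g [set g i]).
    by apply: open_nbhs_nbhs; split => //; exact: discrete_open.
  have /(filterI gi) : nbhs g [set h : {ptws I -> bool} | {in s, h =1 g}].
    by apply: IHs => h.
  apply: filterS => h [hi hs]; apply: sV => j; rewrite inE.
  by move=> /orP[/eqP->//|/hs].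
pose F : set_system {ptws I -> bool} :=
  filter_from [set: seq I]
    (fun s => [set h : {ptws I -> bool} | {in s, h =1 g}]).
have FF : Filter F.
  apply: filter_from_filter; first by exists [::].
  move=> s t _ _; exists (s ++ t) => // h hst.
  by split=> i it; apply: hst; rewrite mem_cat it ?orbT.
(* The product topology is a supremum over the coordinates, so convergence of the cylinder filter
   can be checked one coordinate at a time. *)
suff : F --> g by move=> Fg /Fg[s _ sV]; exists s.
apply/cvg_sup => i U [_ [[W oW <-] Wg] WU].
exists [:: i] => // h hi; apply: WU.
by rewrite /= hi ?inE.
Qed.

Section SubgroupSpace.
Variable A : zmodType.
Local Notation S := (subgroup_space A).
Implicit Types (x y : S) (a b : A) (H K : zmodClosed A).

Lemma nbhs_subgroup x (V : set S) :
  nbhs x V <-> exists s : seq A, forall y, {in s, \val y =1 \val x} -> V y.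
Proof.
split=> [[_ [[W oW <-] Wx] WV]|[s sV]].
  have /nbhs_cylinder[s sW] : nbhs (\val x) W by exact: open_nbhs_nbhs.
  by exists s => y yx; apply: WV; exact: sW.
have : nbhs (\val x) [set h : {ptws A -> bool} | {in s, h =1 \val x}].
  by apply/nbhs_cylinder; exists s.
move=> nx; have : nbhs x
    (set_val @^-1` [set h : {ptws A -> bool} | {in s, h =1 \val x}]).
  apply: (@initial_continuous _ {ptws A -> bool} (set_val : S -> _)).
  by rewrite set_valE.
by apply: filterS => y; rewrite set_valE; apply: sV.
Qed.

Lemma subgroup_closed x : GRing.zmod_closed (\val x : {pred A}).
Proof. exact: (set_valP x). Qed.

(** [to_closed] and [of_closed] pass between points of the space and bundled subgroups, to which the
    algebraic lemmas apply. *)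
Definition to_closed x : zmodClosed A := zmod_of (subgroup_closed x).

Definition of_closed (H : zmodClosed A) : S :=
  exist (fun h => h \in subgroups A) (H : {pred A})
    (@mem_set _ (subgroups A) (H : {pred A}) (GRing.zmodClosedP H)).

Lemma isolated_subgroup x :
  isolated [set: S] x <->
  exists s : seq A, forall y, {in s, \val y =1 \val x} -> y = x.
Proof.
split=> [[_ [V /nbhs_subgroup[s sV]]]|[s sx]].
  by rewrite setIT => Vx; exists s => y /sV; rewrite Vx.
split; first exact: in_setT.
exists [set x]; last by rewrite setIT.
by apply/nbhs_subgroup; exists s.
Qed.


Lemma mem_to_closed x a : (a \in to_closed x) = \val x a.
Proof. by []. Qed.

Lemma val_of_closed H a : \val (of_closed H) a = (a \in H).
Proof. by []. Qed.

Lemma setI_closed H K : GRing.zmod_closed [pred a | (a \in H) && (a \in K)].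
Proof.
split=> [|a b]; rewrite !inE ?rpred0 //.
by move=> /andP[aH aK] /andP[bH bK]; rewrite !rpredB.
Qed.

Lemma pi_eq0 H a : (\pi_(Quotient.quot H)%qT a == 0) = (a \in H).
Proof. by rewrite -{2}[a]subr0 Quotient.idealrBE raddf0. Qed.

Lemma preimage_closed H (K : zmodClosed (Quotient.quot H)) :
  GRing.zmod_closed [pred a | \pi_(Quotient.quot H)%qT a \in K].
Proof.
split=> [|a b]; rewrite !inE ?raddf0 ?rpred0 //.
by move=> aK bK; rewrite raddfB rpredB.
Qed.

Lemma image_closed H K :
  GRing.zmod_closed
    [pred q | `[< exists2 a, a \in K & q = \pi_(Quotient.quot H)%qT a >]].
Proof.
split=> [|_ _ /asboolP[a aK ->] /asboolP[b bK ->]]; apply/asboolP.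
  by exists 0; rewrite ?rpred0 ?raddf0.
by exists (a - b); rewrite ?rpredB ?raddfB.
Qed.

Lemma exists_isolated_subgroup :
  (exists x, isolated [set: S] x) <->
  exists2 Z : zmodClosed A,
    finitely_generated Z & finitely_discriminable (Quotient.quot Z).
Proof.
split=> [[x /isolated_subgroup[s sx]]|[Z [s [sZ genZ]] [E [E0 EP]]]].
  pose Z := to_closed x; exists Z.
    exists [seq a <- s | a \in Z].
    split=> [a|K sK a aZ]; first by rewrite mem_filter => /andP[].
    (* [K] contains the elements of [s] lying in [Z], so the intersection of [Z] and [K] agrees with
       [Z] on [s]. *)
    have eqx : of_closed (zmod_of (setI_closed Z K)) = x.
      apply: sx => b bs; rewrite val_of_closed -mem_to_closed inE -/Z.
      by case: (boolP (b \in Z)) => //= bZ; apply: sK; rewrite mem_filter bZ.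
    by move: aZ; rewrite mem_to_closed -[in X in X -> _]eqx => /andP[].
  exists [seq \pi_(Quotient.quot Z)%qT a | a <- s & a \notin Z]; split.
    by apply/mapP => -[a]; rewrite mem_filter -pi_eq0 => /andP[/eqP + _] /esym.
  move=> K [k kK k0]; apply: contrapT => KE.
  (* When [K] avoids the images of the elements of [s] outside [Z], its preimage agrees with [Z] on
     [s]; hence [K] is trivial. *)
  have eqx : of_closed (zmod_of (preimage_closed K)) = x.
    apply: sx => b bs; rewrite val_of_closed -mem_to_closed inE -/Z.
    have [bZ|bZ] := boolP (b \in Z).
      by move: (bZ); rewrite -pi_eq0 => /eqP->; rewrite rpred0.
    apply/negP => bK; apply: KE; exists (\pi_(Quotient.quot Z)%qT b) => //.
    by apply: map_f; rewrite mem_filter bZ.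
  have : repr k \in Z.
    by rewrite mem_to_closed -eqx val_of_closed inE reprK.
  by rewrite -pi_eq0 reprK; apply/negP.
exists (of_closed Z); apply/isolated_subgroup.
(* Agreement on the generators [s] gives [Z <= K]; agreement on representatives of [E] gives the
   converse. *)
exists (s ++ map repr E) => y yZ; pose K := to_closed y.
have ZK : {subset Z <= K}.
  apply: genZ => a sa.
  by rewrite mem_to_closed yZ ?mem_cat ?sa // val_of_closed sZ.
have KZ : {subset K <= Z}.
  move=> a aK; apply: contraT; rewrite -pi_eq0 => a0.
  (* A nontrivial image of [K] contains some [e] in [E]. As [Z <= K], the representative of [e] is
     in [K], hence in [Z], and [e = 0]. *)
  have [|e eE /asboolP[b bK eb]] := EP (zmod_of (image_closed Z K)).
    by exists (\pi_(Quotient.quot Z)%qT a) => //; apply/asboolP; exists a.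
  have : repr e \in Z.
    rewrite -val_of_closed -yZ ?mem_cat ?map_f ?orbT // -mem_to_closed -/K.
    by rewrite -(subrK b (repr e)) rpredD // ZK // Quotient.idealrBE reprK eb.
  by rewrite -pi_eq0 reprK => /eqP e0; rewrite -e0 eE in E0.
apply: val_inj; apply: funext => a; rewrite val_of_closed -mem_to_closed -/K.
by apply/idP/idP; [exact: KZ | exact: ZK].
Qed.

End SubgroupSpace.

(** * Compactness, separation and perfectness of the space of subgroups *)

Section CantorSpace.
Variable A : zmodType.
Local Notation S := (subgroup_space A).

(** Each subgroup axiom involves at most three elements, on which a limit point [h] agrees with an
    actual subgroup. *)
Lemma closed_subgroups : closed (subgroups A).
Proof.
move=> h ch.
have near (s : seq A) :
    exists H : zmodClosed A, {in s, forall a, h a = (a \in H)}.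
  have [|g [gS gs]] := ch [set g : {ptws A -> bool} | {in s, g =1 h}].
    by apply/nbhs_cylinder; exists s.
  by exists (zmod_of gS) => a sa; rewrite -gs.
split=> [|a b ha hb].
  by have [H HP] := near [:: 0]; rewrite unfold_in HP ?inE ?rpred0.
have [H HP] := near [:: a; b; a - b].
by move: ha hb; rewrite !unfold_in !HP ?inE ?eqxx ?orbT //; apply: rpredB.
Qed.

Lemma compact_subgroup_space : compact [set: S].
Proof.
have cS : compact (subgroups A).
  apply: (subclosed_compact closed_subgroups
    (B := [set: {ptws A -> bool}])) => //.
  have := @tychonoff A (fun=> bool) (fun=> setT) (fun=> bool_compact).
  by congr compact; apply/seteqP.
(* The filter is pushed forward to the power of [bool], where it has a cluster point that is a
   subgroup; cylinders carry this back to the subspace. *)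
move=> F PF _.
have [|h [hS Fh]] := cS ((fun x : S => \val x) @ F).
  by apply: (@filterE S F) => x; exact: subgroup_closed.
exists (of_closed (zmod_of hS)); split => // P Q FP /nbhs_subgroup[s sQ].
have [||_ [[y Py <-] hy]] :=
  Fh (val @` P) [set g : {ptws A -> bool} | {in s, g =1 h}].
- by apply: (@filterS S F _ P) FP => y Py; exists y.
- by apply/nbhs_cylinder; exists s.
by exists y; split => //; exact: sQ.
Qed.

Lemma zero_dimensional_subgroup_space : zero_dimensional S.
Proof.
move=> x y xy.
have [a /eqP xya] : exists a, \val x a <> \val y a.
  by apply/existsNP => xyE; move/eqP: xy; apply; apply: val_inj; exact: funext.
exists [set z : S | \val z a = \val x a].
split => //=; last by apply/eqP; rewrite eq_sym.
have openV (b : bool) : open [set z : S | \val z a = b].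
  rewrite openE => z /= za; apply/nbhs_subgroup; exists [:: a] => w wz /=.
  by rewrite wz ?inE.
split=> //; rewrite -openC.
rewrite (_ : ~` _ = [set z : S | \val z a = ~~ \val x a]) //.
by apply/seteqP; split=> z /=; case: (\val z a) (\val x a) => [] [].
Qed.

Lemma hausdorff_subgroup_space : hausdorff_space S.
Proof.
move=> x y xy; apply: contrapT => /eqP /zero_dimensional_subgroup_space.
case=> U [[oU cU] Ux Uy].
have [||z []//] := xy U (~` U); apply: open_nbhs_nbhs; split => //.
exact: closed_openC.
Qed.

Lemma perfect_subgroup_space : perfect_space S -> perfect_set [set: S].
Proof.
move=> pS; apply/perfectTP => x ox; apply: pS; exists x.
split; first exact: in_setT.
by exists [set x]; [exact: open_nbhs_nbhs | rewrite setIT].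
Qed.

End CantorSpace.

(** * Metrizability for countable groups, and the homeomorphism with the Cantor space *)

Lemma countable_uniformity_initial (T : choiceType) (U : uniformType)
    (f : T -> U) :
  countable_uniformity U -> countable_uniformity (initial_topology f).
Proof.
move=> /countable_uniformityP[g gsub gent]; apply/countable_uniformityP.
exists (fun n => [set xy | g n (f xy.1, f xy.2)]) => [E [V entV VE]|n].
  by have [N gN] := gsub V entV; exists N; apply: subset_trans VE => xy /gN.
by exists (g n).
Qed.

Lemma countable_uniformity_prod (I : Type) (T : I -> uniformType) :
    countable [set: I] -> (forall i, countable_uniformity (T i)) ->
  countable_uniformity (prod_topology T).
Proof.
move=> cI cT.
apply: (@countable_sup_ent _ _
  (fun i => Uniform.class (initial_topology (fun f : prod_topology T => f i)))
  cI) => i.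
exact: (@countable_uniformity_initial (prod_topology T) (T i) (fun f => f i)).
Qed.

Lemma subgroup_space_cantor (R : realType) (A : zmodType) :
  countable [set: A] -> cantor_like (subgroup_space A) ->
  homeomorphic (subgroup_space A) cantor_space.
Proof.
move=> cA cantorS.
pose U : uniformType := set_type (subgroups A).
have cU : countable_uniformity U.
  apply: countable_uniformity_initial; apply: countable_uniformity_prod => // _.
  exact: (@countable_uniformity_metric R bool).
pose M : pseudoMetricType R := countable_uniform cU.
(* The characterization of the Cantor space asks for a pointed space; the base point is the trivial
   subgroup, an empty span. *)
pose P : pseudoPMetricType R :=
  HB.pack (M : Type) (isPointed.Build M (of_closed (span (fun=> 0) 0 0))) M.
have [f [cf clf]] := @homeomorphism_cantor_like R P cantorS.
have fK : cancel f f^-1%FUN by move=> x; rewrite funK ?inE.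
have gK : cancel f^-1%FUN f by move=> x; rewrite invK ?inE.
exists f^-1%FUN, f; split => //.
(* The preimage of [C] under the inverse of [f] is its image under the closed map [f]. *)
apply/continuous_closedP => C /clf.
congr closed; apply/seteqP; split=> [_ [x Cx <-]|x Cx] /=; first by rewrite fK.
by exists (f^-1%FUN x).
Qed.

Theorem propositionA (A : zmodType) :
  [/\ ~ perfect_space (subgroup_space A) <-> minimax A,
      countable [set: A] -> ~ minimax A ->
        homeomorphic (subgroup_space A) cantor_space
    & ~ countable [set: A] -> perfect_space (subgroup_space A)].
Proof.
have minimaxP : (exists x, isolated [set: subgroup_space A] x) <-> minimax A.
  split=> [/exists_isolated_subgroup[Z fgZ fdZ]|[Z [fgZ artZ]]].
    by exists Z; split=> //; exact: finitely_discriminable_artinian.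
  apply/exists_isolated_subgroup; exists Z => //.
  exact: artinian_finitely_discriminable.
split.
- by rewrite /perfect_space notE.
- move=> cA nmA; apply: (@subgroup_space_cantor Rdefinitions.R) => //; split.
  + by apply: perfect_subgroup_space => /minimaxP.
  + exact: compact_subgroup_space.
  + exact: hausdorff_subgroup_space.
  + exact: zero_dimensional_subgroup_space.
- by move=> ncA /minimaxP/minimax_countable.
Qed.
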